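(* Let $M$ be a $d\times d$ dilation matrix, $m=|\det M|$, let $n\ge0$ be an integer, and let $t$ be a trigonometric polynomial with polyphase functions $\tau_0,\dots,\tau_{m-1}$. Put $\lambda_\alpha=D^\alpha\big[t({M^*}^{-1}x)\big]\big|_{x=\mathbf{0}}$ for $\alpha\in\mathbb{Z}_+^d$. Then $t\in\mathcal{Z}^n$ if and only if for every $k=0,\dots,m-1$ and every $\alpha\in\mathbb{Z}^d_+$ with $[\alpha]\le n$ $$D^\alpha\tau_k(\mathbf{0})=\frac1m\sum_{\mathbf{0}\le\beta\le\alpha}\lambda_\beta\binom{\alpha}{\beta}(-2\pi i\,r_k)^{\alpha-\beta}.$$
   Context: A dilation matrix $M$ is a non-degenerate $d\times d$ integer matrix all of whose eigenvalues are larger than $1$ in modulus; $M^*$ is its transpose, $m=|\det M|$. $D(M)=\{s_0,\dots,s_{m-1}\}$ and $D(M^* )=\{s_0^*,\dots,s_{m-1}^*\}$ are sets of representatives (digits) of the cosets $\mathbb{Z}^d/M\mathbb{Z}^d$ and $\mathbb{Z}^d/M^*\mathbb{Z}^d$, with $s_0=s_0^*=\mathbf{0}$; $r_k=M^{-1}s_k$, $k=0,\dots,m-1$. A trigonometric polynomial is a function $t(x)=\sum_{n\in\mathbb{Z}^d}\widehat t(n)e^{2\pi i(n,x)}$, $x\in\mathbb{R}^d$, with only finitely many non-zero coefficients. Its polyphase functions $\tau_0,\dots,\tau_{m-1}$ are the unique trigonometric polynomials with $t(x)=\sum_{\nu=0}^{m-1}e^{2\pi i(s_\nu,x)}\tau_\nu(M^*x)$,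 i.e. $\tau_\nu(x)=\sum_{n\in\mathbb{Z}^d}\widehat t(Mn+s_\nu)e^{2\pi i(n,x)}$. For $n\ge0$, $\mathcal{Z}^n$ is the set of trigonometric polynomials $t$ such that $D^\beta\big[t({M^*}^{-1}x)\big]\big|_{x=s}=0$ for all $s\in D(M^* )$, $s\ne\mathbf{0}$, and all $\beta\in\mathbb{Z}_+^d$ with $[\beta]:=\beta_1+\dots+\beta_d\le n$. Multi-index notation: $a^b=\prod_j a_j^{b_j}$, $\binom{\alpha}{\beta}=\prod_j\binom{\alpha_j}{\beta_j}$, and $\beta\le\alpha$ is meant componentwise. *)

(* Defs.v *)
(* MathComp + MathComp-Analysis; complex numbers are R[i] over a realType R. *)
From HB Require Import structures.
From mathcomp Require Import all_boot all_order all_algebra.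
From mathcomp Require Import complex.
From mathcomp Require Import all_classical all_reals all_analysis.

Set Implicit Arguments.
Unset Strict Implicit.
Unset Printing Implicit Defensive.

Import Order.TTheory GRing.Theory Num.Theory.
Import numFieldNormedType.Exports.

Local Open Scope classical_set_scope.
Local Open Scope ring_scope.

(* Points of R^d and Z^d are column vectors. *)

Definition intmx (K : pzRingType) (p q : nat) (A : 'M[int]_(p, q)) :
    'M[K]_(p, q) :=
  map_mx (fun a : int => a%:~R) A.

(* `|z| is the modulus of z, seen as an element of R[i], whose order
   restricts to the usual one on reals. *)
Definition dilation_matrix (R : realType) (d : nat) (M : 'M[int]_d) : Prop :=
  \det M != 0 /\
  forall z : R[i], eigenvalue (intmx R[i] M) z -> 1 < `|z|.

(* s enumerates a set of representatives of Z^d / A Z^d, with s_0 = 0. *)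
Definition digits (d m : nat) (A : 'M[int]_d) (s : 'I_m -> 'cV[int]_d) : Prop :=
  (forall z : 'cV[int]_d,
     exists! k : 'I_m, exists q : 'cV[int]_d, z = A *m q + s k) /\
  (forall k : 'I_m, k = 0%N :> nat -> s k = 0).

Definition dotZ (R : realType) (d : nat) (n : 'cV[int]_d) (x : 'cV[R]_d) : R :=
  \sum_(j < d) (n j 0)%:~R * x j 0.

(* e^{2 pi i u} *)
Definition cexp2pi (R : realType) (u : R) : R[i] :=
  (cos (2 * pi * u) +i* sin (2 * pi * u))%C.

Definition trig_poly (R : realType) (d : nat) (t : 'cV[R]_d -> R[i]) : Prop :=
  exists c : 'cV[int]_d -> R[i],
    finite_set [set n | c n != 0] /\
    forall x, t x = \sum_(n \in [set: 'cV[int]_d]) c n * cexp2pi (dotZ n x).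

Definition polyphase (R : realType) (d m : nat) (M : 'M[int]_d)
    (s : 'I_m -> 'cV[int]_d) (t : 'cV[R]_d -> R[i])
    (tau : 'I_m -> 'cV[R]_d -> R[i]) : Prop :=
  (forall k, trig_poly (tau k)) /\
  forall x, t x = \sum_(k < m) cexp2pi (dotZ (s k) x) * tau k (intmx R M^T *m x).

(* R[i] is not a normed module over R in the library, so the j-th partial
   derivative of a complex-valued function is taken on the real and imaginary
   parts separately. *)
Definition partial (R : realType) (d : nat) (j : 'I_d) (f : 'cV[R]_d -> R[i]) :
    'cV[R]_d -> R[i] :=
  fun x => ('D_(delta_mx j 0) (fun y => complex.Re (f y)) x +i*
            'D_(delta_mx j 0) (fun y => complex.Im (f y)) x)%C.

(* D^b f, i.e. d_1^{b_1} ( ... (d_d^{b_d} f)) *)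
Definition Dmulti (R : realType) (d : nat) (b : 'I_d -> nat)
    (f : 'cV[R]_d -> R[i]) : 'cV[R]_d -> R[i] :=
  foldr (fun j g => iter (b j) (partial j) g) f (enum 'I_d).

Definition midx_sum (d : nat) (b : 'I_d -> nat) : nat := (\sum_(j < d) b j)%N.

Definition midx_binom (d : nat) (a b : 'I_d -> nat) : nat :=
  (\prod_(j < d) 'C(a j, b j))%N.

Definition midx_pow (K : comPzRingType) (d : nat) (v : 'cV[K]_d)
    (a : 'I_d -> nat) : K :=
  \prod_(j < d) v j 0 ^+ a j.

(* x |-> t(M^{*-1} x) *)
Definition dilated (R : realType) (d : nat) (M : 'M[int]_d)
    (t : 'cV[R]_d -> R[i]) : 'cV[R]_d -> R[i] :=
  fun x => t (invmx (intmx R M^T) *m x).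

Definition classZ (R : realType) (d m : nat) (M : 'M[int]_d)
    (sstar : 'I_m -> 'cV[int]_d) (n : nat) (t : 'cV[R]_d -> R[i]) : Prop :=
  trig_poly t /\
  forall k : 'I_m, sstar k != 0 ->
    forall b : 'I_d -> nat, (midx_sum b <= n)%N ->
      Dmulti b (dilated M t) (intmx R (sstar k)) = 0.

Definition lambda_coef (R : realType) (d : nat) (M : 'M[int]_d)
    (t : 'cV[R]_d -> R[i]) (a : 'I_d -> nat) : R[i] :=
  Dmulti a (dilated M t) 0.

(* r = M^{-1} s *)
Definition rvec (R : realType) (d : nat) (M : 'M[int]_d) (s : 'cV[int]_d) :
    'cV[R]_d :=
  invmx (intmx R M) *m intmx R s.

Definition m2piI (R : realType) (d : nat) (v : 'cV[R]_d) : 'cV[R[i]]_d :=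
  \col_j (- (2 * (pi : R)%:C%C * 'i%C * (v j 0)%:C%C)).

(* Main.v *)
Require Import Defs.
From HB Require Import structures.
From mathcomp Require Import all_boot all_order all_algebra.
From mathcomp Require Import complex.
From mathcomp Require Import all_classical all_reals all_analysis.
From mathcomp Require Import ring lra.

Set Implicit Arguments.
Unset Strict Implicit.
Unset Printing Implicit Defensive.

Import Order.TTheory GRing.Theory Num.Theory.
Import numFieldNormedType.Exports.

Local Open Scope ring_scope.

(** Write e(u) for e^{2 pi i u} and T(x) = t(M^*^{-1} x).  Substituting
    M^*^{-1} x in the polyphase decomposition gives T = sum_k g_k with
    g_k(x) = e(r_k . x) tau_k(x).  Since tau_k is Z^d-periodic, for z in Z^d

      D^b T(z) = sum_k e(r_k . z) D^b g_k(0),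

    so the derivatives of T at the digits s^*_l are the images of the vector
    (D^b g_k(0))_k under the matrix E = (e(r_k . s^*_l))_{l,k}.  This is the
    character table of Z^d / M Z^d: its rows are orthogonal, hence E is
    invertible, and E c = 0 off the row l = 0 exactly when c is a constant
    vector ([character_sums_vanish]).  Therefore t is in Z^n if and only if,
    for each [b] <= n, the number D^b g_k(0) does not depend on k; as these
    numbers add up to D^b T(0) = lambda_b, they are then all lambda_b / m.

    Finally tau_k(x) = e(- r_k . x) g_k(x), and the Leibniz rule writes
    D^a tau_k(0) as the binomial transform of b |-> D^b g_k(0) with weights
    (- 2 pi i r_k)^{a-b}.  The formula to prove is the same transform of
    b |-> lambda_b / m, and the transform, being unitriangular for the order
    of multi-indices, is injective on [a] <= n ([binom_transform_inj]).

    All the functions involved are finite sums of exponentials e(v . x) with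
    real frequencies v, on which D^b multiplies each coefficient by
    (2 pi i v)^b ([Dmulti_waves]).  So differentiation is only ever computed on
    single exponentials, and the Leibniz rule reduces to the binomial theorem
    for (v + r_k) - r_k ([polyphase_derivatives]). *)

(** * The character u |-> e^{2 pi i u} *)

Lemma cexp2piD (R : realType) (u v : R) :
  cexp2pi (u + v) = cexp2pi u * cexp2pi v.
Proof.
rewrite /cexp2pi mulrDr cosD sinD.
rewrite -[RHS]/((_ +i* _)%C); congr (_ +i* _)%C.
by rewrite addrC.
Qed.

Lemma cexp2pi0 (R : realType) : cexp2pi (0 : R) = 1.
Proof. by rewrite /cexp2pi mulr0 cos0 sin0. Qed.

Lemma cexp2pi_int (R : realType) (n : int) : cexp2pi (n%:~R : R) = 1.
Proof.
have cexp_nat k : cexp2pi (k%:R : R) = 1.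
  elim: k => [|k IH]; first exact: cexp2pi0.
  rewrite mulrSr cexp2piD IH mul1r /cexp2pi mulr1 mulr_natl.
  by rewrite -[pi *+ 2]add0r sinD2pi cosD2pi cos0 sin0.
case: n => k; first exact: cexp_nat.
have := cexp2piD ((Negz k)%:~R : R) k.+1%:R.
by rewrite NegzE mulrNz addNr cexp2pi0 cexp_nat mulr1.
Qed.

(** With f the fractional part of u, cos (2 pi f) = 1 forces sin (pi f) = 0,
    whereas sin is positive on ]0, pi[. *)
Lemma cexp2pi_eq1 (R : realType) (u : R) :
  cexp2pi u = 1 -> exists n : int, u = n%:~R.
Proof.
move=> u1; exists (Num.floor u).
pose f := u - (Num.floor u)%:~R.
have f_ge0 : 0 <= f by rewrite subr_ge0 Num.Theory.floor_le.
have f_lt1 : f < 1.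
  by rewrite ltrBlDl; have := Num.Theory.floorD1_gt u; rewrite intrD1.
have f1 : cexp2pi f = 1.
  have := cexp2piD f (Num.floor u)%:~R.
  by rewrite cexp2pi_int mulr1 /f subrK u1 => <-.
have [/eqP f0|fn0] := boolP (f == 0).
  by apply/eqP; rewrite -subr_eq0 -/f f0.
have sgt0 : 0 < sin (pi * f).
  have f_gt0 : 0 < f by rewrite lt_neqAle eq_sym fn0.
  by apply: sin_gt0_pi; rewrite mulr_gt0 ?pi_gt0 //= gtr_pMr ?pi_gt0.
have : cos (2 * pi * f) = 1 by case: f1.
rewrite -mulrA mulr_natl cos_mulr2n => c1.
have := cos2Dsin2 (pi * f) => c2.
have : sin (pi * f) ^+ 2 = 0 by lra.
by move/eqP; rewrite expf_eq0 /= (gt_eqF sgt0).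
Qed.

(** * Derivatives of finite sums of exponentials *)

Definition dotR (R : realType) (d : nat) (v x : 'cV[R]_d) : R :=
  \sum_(j < d) v j 0 * x j 0.

(** The symbol of the gradient on the exponential of frequency v: each partial
    derivative multiplies it by the corresponding entry. *)
Definition p2piI (R : realType) (d : nat) (v : 'cV[R]_d) : 'cV[R[i]]_d :=
  \col_j (2 * (pi : R)%:C%C * 'i%C * (v j 0)%:C%C).

Lemma dotZE (R : realType) (d : nat) (n : 'cV[int]_d) (x : 'cV[R]_d) :
  dotZ n x = dotR (intmx R n) x.
Proof. by apply: eq_bigr => j _; rewrite mxE. Qed.

Lemma dotRE (R : realType) (d : nat) (v x : 'cV[R]_d) :
  dotR v x = (v^T *m x) 0 0.
Proof. by rewrite mxE; apply: eq_bigr => j _; rewrite mxE. Qed.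

Lemma dotRDl (R : realType) (d : nat) (u v x : 'cV[R]_d) :
  dotR (u + v) x = dotR u x + dotR v x.
Proof. by rewrite !dotRE linearD mulmxDl mxE. Qed.

Lemma dotRDr (R : realType) (d : nat) (v x y : 'cV[R]_d) :
  dotR v (x + y) = dotR v x + dotR v y.
Proof. by rewrite !dotRE mulmxDr mxE. Qed.

Lemma dotRZr (R : realType) (d : nat) (h : R) (v x : 'cV[R]_d) :
  dotR v (h *: x) = h * dotR v x.
Proof. by rewrite !dotRE -scalemxAr mxE. Qed.

Lemma dotR_delta (R : realType) (d : nat) (v : 'cV[R]_d) (j : 'I_d) :
  dotR v (delta_mx j 0) = v j 0.
Proof.
rewrite /dotR (bigD1 j) //= mxE !eqxx mulr1 big1 ?addr0 // => i /negbTE ij.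
by rewrite mxE ij mulr0.
Qed.

(** A directional derivative is a derivative along a line, which gives access
    to the one-variable chain rule. *)
Lemma is_derive_line (R : realType) (d : nat) (x w : 'cV[R]_d)
    (f : 'cV[R]_d -> R) (df : R) :
  is_derive (0 : R) 1 (fun h : R => f (h *: w + x)) df -> is_derive x w f df.
Proof.
case=> dv1 dv2; apply: DeriveDef; first exact/(derivable1P f x w).
rewrite -dv2 /derive; set g1 := fun h => h^-1 *: _; set g2 := fun h => h^-1 *: _.
suff -> : g1 = g2 by [].
by apply/funext => h; rewrite /g1 /g2 /= addr0 scale0r add0r [_%:A]mulr1.
Qed.

Lemma is_derive_dotR (R : realType) (d : nat) (x v : 'cV[R]_d) (j : 'I_d)
    (f : R -> R) (a : R) :
  is_derive (dotR v x) 1 f a ->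
  is_derive x (delta_mx j 0) (fun y => f (dotR v y)) (v j 0 * a).
Proof.
move=> fa; apply: is_derive_line.
have -> : (fun h : R => f (dotR v (h *: delta_mx j 0 + x))) =
          f \o (fun h => h * v j 0 + dotR v x).
  by apply/funext => h /=; rewrite dotRDr dotRZr dotR_delta.
rewrite mulrC; apply: is_derive1_comp.
  by rewrite mul0r add0r.
have -> : (fun h : R => h * v j 0 + dotR v x) =
          (v j 0 \*: id) + cst (dotR v x).
  by apply/funext => h /=; rewrite fctE /= mulrC.
by apply: is_derive_eq; rewrite addr0 [_ *: 1]mulr1.
Qed.

(** Unlike [partial], this carries differentiability, which is what makes it
    stable under sums. *)
Definition has_partial (R : realType) (d : nat) (j : 'I_d)
    (f : 'cV[R]_d -> R[i]) (x : 'cV[R]_d) (z : R[i]) : Prop :=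
  is_derive x (delta_mx j 0) (fun y => complex.Re (f y)) (complex.Re z) /\
  is_derive x (delta_mx j 0) (fun y => complex.Im (f y)) (complex.Im z).

Lemma has_partialP (R : realType) (d : nat) (j : 'I_d)
    (f : 'cV[R]_d -> R[i]) (x : 'cV[R]_d) (z : R[i]) :
  has_partial j f x z -> partial j f x = z.
Proof.
move=> [re im]; rewrite /partial (@derive_val _ _ _ _ _ _ _ re).
by rewrite (@derive_val _ _ _ _ _ _ _ im); case: z {re im}.
Qed.

Lemma has_partial_sum (R : realType) (d : nat) (j : 'I_d) (I : Type)
    (r : seq I) (f : I -> 'cV[R]_d -> R[i]) (x : 'cV[R]_d) (z : I -> R[i]) :
  (forall i, has_partial j (f i) x (z i)) ->
  has_partial j (fun y => \sum_(i <- r) f i y) x (\sum_(i <- r) z i).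
Proof.
move=> fz; elim: r => [|i r [re im]].
  rewrite /has_partial big_nil /=.
  by under eq_fun do rewrite big_nil;
     under [X in _ /\ is_derive _ _ X _]eq_fun do rewrite big_nil;
     split; exact: is_derive_cst.
have [rei imi] := fz i.
rewrite /has_partial big_cons; split.
  under eq_fun do rewrite big_cons raddfD /=.
  by rewrite raddfD; exact: is_deriveD.
under eq_fun do rewrite big_cons raddfD /=.
by rewrite raddfD; exact: is_deriveD.
Qed.

Lemma has_partial_wave (R : realType) (d : nat) (j : 'I_d) (c : R[i])
    (v x : 'cV[R]_d) :
  has_partial j (fun y => c * cexp2pi (dotR v y)) x
    (c * p2piI v j 0 * cexp2pi (dotR v x)).
Proof.
have dlin (u : R) : is_derive u 1 (fun w => 2 * pi * w) (2 * pi).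
  rewrite (_ : (fun w => _) = (2 * pi) \*: id) //.
  by apply: is_derive_eq; rewrite [_ *: 1]mulr1.
have dcos : is_derive x (delta_mx j 0)
    (fun y => cos (2 * pi * dotR v y))
    (v j 0 * (- sin (2 * pi * dotR v x) * (2 * pi))).
  apply: (@is_derive_dotR _ _ _ _ _ (fun w => cos (2 * pi * w))).
have dsin : is_derive x (delta_mx j 0)
    (fun y => sin (2 * pi * dotR v y))
    (v j 0 * (cos (2 * pi * dotR v x) * (2 * pi))).
  apply: (@is_derive_dotR _ _ _ _ _ (fun w => sin (2 * pi * w))).
case: c => a b; rewrite /p2piI mxE /has_partial /cexp2pi /=; split.
  rewrite (_ : (fun y => _) =
    (a \*: (fun y => cos (2 * pi * dotR v y))) -
    (b \*: (fun y => sin (2 * pi * dotR v y)))) //.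
  apply: is_derive_eq; rewrite /GRing.scale /=; ring.
rewrite (_ : (fun y => _) =
    (a \*: (fun y => sin (2 * pi * dotR v y))) +
    (b \*: (fun y => cos (2 * pi * dotR v y)))) //.
apply: is_derive_eq; rewrite /GRing.scale /=; ring.
Qed.

(** Exponentials are common eigenfunctions of the partial derivatives. *)
Lemma Dmulti_waves (R : realType) (d : nat) (b : 'I_d -> nat) (I : Type)
    (r : seq I) (c : I -> R[i]) (v : I -> 'cV[R]_d) (f : 'cV[R]_d -> R[i]) :
  (forall x, f x = \sum_(i <- r) c i * cexp2pi (dotR (v i) x)) ->
  forall x, Dmulti b f x =
    \sum_(i <- r) c i * midx_pow (p2piI (v i)) b * cexp2pi (dotR (v i) x).
Proof.
move=> /funext -> {f} x.
rewrite /Dmulti /midx_pow; under eq_bigr do rewrite -big_enum /=.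
move: x; apply/funeqP; elim: (enum _) => [|j s IH] /=.
  by apply/funext => x; apply: eq_bigr => i _; rewrite big_nil mulr1.
rewrite {}IH.
pose P i := \prod_(l <- s) p2piI (v i) l 0 ^+ b l.
have -> : (fun x => \sum_(i <- r) c i *
      (\prod_(l <- j :: s) p2piI (v i) l 0 ^+ b l) * cexp2pi (dotR (v i) x)) =
    (fun x => \sum_(i <- r) c i * (P i * p2piI (v i) j 0 ^+ b j) *
      cexp2pi (dotR (v i) x)).
  by apply/funext => x; apply: eq_bigr => i _; rewrite big_cons [_ * P i]mulrC.
elim: (b j) => [|k IHk] /=.
  by apply/funext => x; apply: eq_bigr => i _; rewrite mulr1.
rewrite {}IHk; apply/funext => x; apply: has_partialP.
apply: has_partial_sum => i; rewrite exprSr [P i * (_ * _)]mulrA [c i * (_ * p2piI _ _ _)]mulrA.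
exact: has_partial_wave.
Qed.

(** Turns the sum over all of Z^d into one over an explicit finite list. *)
Lemma trig_poly_sum (R : realType) (d : nat) (t : 'cV[R]_d -> R[i]) :
  trig_poly t -> exists (r : seq 'cV[int]_d) (c : 'cV[int]_d -> R[i]),
    forall x, t x = \sum_(n <- r) c n * cexp2pi (dotR (intmx R n) x).
Proof.
case=> c [fin tE]; exists (finmap.enum_fset (fset_set [set n | c n != 0]%classic)), c => x.
rewrite tE (fsbigTE (fset_set [set n | c n != 0]%classic)).
  by apply: eq_bigr => n _; rewrite dotZE.
move=> n; rewrite in_fset_set // notin_setE /= => /negP; rewrite negbK => /eqP ->.
by rewrite mul0r.
Qed.

(** * The multivariate binomial transform *)

(** Distribute the product over the coordinates of the one-variable binomial
    formulas; a choice of one term in each is a multi-index b <= a. *)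
Lemma midx_pow_binomial (K : comPzRingType) (d : nat) (x y : 'cV[K]_d)
    (a : 'I_d -> nat) :
  midx_pow (x + y) a =
  \sum_(b : {ffun 'I_d -> 'I_(midx_sum a).+1} | [forall j, (b j <= a j)%N])
    midx_pow x (fun j => b j) * (midx_binom a (fun j => b j))%:R *
    midx_pow y (fun j => (a j - b j)%N).
Proof.
have aj_le j : ((a j).+1 <= (midx_sum a).+1)%N.
  by rewrite ltnS /midx_sum (bigD1 j) //= leq_addr.
rewrite /midx_pow; under eq_bigr => j _.
  rewrite mxE addrC exprDn (big_ord_widen _ (fun i =>
    y j 0 ^+ (a j - i) * x j 0 ^+ i *+ 'C(a j, i)) (aj_le j)).
  under eq_bigl do rewrite ltnS.
  over.
rewrite bigA_distr_big_dep; apply: eq_big => [b|b _] /=.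
  apply/familyP/forallP => h j; exact: h.
rewrite /midx_binom natr_prod -!big_split; apply: eq_bigr => j _ /=.
by rewrite -mulr_natr [_ * x j 0 ^+ _]mulrC mulrAC.
Qed.

Definition binom_transform (K : comPzRingType) (d : nat) (y : 'cV[K]_d)
    (f : ('I_d -> nat) -> K) (a : 'I_d -> nat) : K :=
  \sum_(b : {ffun 'I_d -> 'I_(midx_sum a).+1} | [forall j, (b j <= a j)%N])
    f (fun j => b j) * (midx_binom a (fun j => b j))%:R *
    midx_pow y (fun j => (a j - b j)%N).

(** In the transform at a, the value f a has coefficient 1 and all the others
    are f b with b <= a and [b] < [a]: induction on [a]. *)
Lemma binom_transform_inj (K : comPzRingType) (d : nat) (y : 'cV[K]_d)
    (f g : ('I_d -> nat) -> K) (n : nat) :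
  (forall a, (midx_sum a <= n)%N ->
     binom_transform y f a = binom_transform y g a) <->
  (forall a, (midx_sum a <= n)%N -> f a = g a).
Proof.
split=> fg a an; last first.
  apply: eq_bigr => b /forallP ba; rewrite fg //.
  by apply: leq_trans an; apply: leq_sum.
have [N] := ubnP (midx_sum a); elim: N => // N IH in a an *.
rewrite ltnS => aN.
have aj_le j : (a j < (midx_sum a).+1)%N.
  by rewrite ltnS /midx_sum (bigD1 j) //= leq_addr.
(* The multi-index a itself, as an element of the index type of the sum. *)
pose a' : {ffun 'I_d -> 'I_(midx_sum a).+1} := [ffun j => Ordinal (aj_le j)].
have a'E : (fun j => a' j : nat) = a by apply/funext => j; rewrite ffunE.
have a'a : [forall j, (a' j <= a j)%N] by apply/forallP => j; rewrite ffunE.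
have := fg a an; rewrite /binom_transform !(bigD1 a' a'a) /= a'E.
under eq_bigr => b /andP[/forallP ba b_neq].
  rewrite (IH (fun j => b j)); last 2 first.
  - by apply: leq_trans an; apply: leq_sum.
  - apply: leq_trans aN; rewrite ltnNge; apply: contra b_neq => ab.
    apply/eqP/ffunP => j; apply/val_inj => /=; rewrite ffunE /=.
    apply/eqP; rewrite eqn_leq ba /= leqNgt; apply/negP => bj.
    move: ab; rewrite leqNgt /midx_sum => /negP; apply.
    rewrite (bigD1 j) //= [X in (_ < X)%N](bigD1 j) //=.
    by rewrite -addSn leq_add // leq_sum.
  over.
move=> /addIr.
have -> : midx_binom a a = 1%N by rewrite /midx_binom big1 // => j _; exact: binn.
have -> : midx_pow y (fun j => (a j - a' j)%N) = 1.
  by rewrite /midx_pow big1 // => j _; rewrite ffunE /= subnn expr0.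
by rewrite !mulr1.
Qed.

(** * Characters of Z^d / M Z^d *)

Lemma intmx_tr (R : realType) (p q : nat) (A : 'M[int]_(p, q)) :
  (intmx R A)^T = intmx R A^T.
Proof. exact: map_trmx. Qed.

Lemma intmx_inj (R : realType) (p q : nat) :
  injective (@intmx R p q).
Proof.
move=> A B /matrixP AB; apply/matrixP => i j.
by apply: (@intr_inj R); have := AB i j; rewrite !mxE.
Qed.

Lemma intmx_unit (R : realType) (d : nat) (M : 'M[int]_d) :
  \det M != 0 -> intmx R M \in unitmx.
Proof. by move=> M0; rewrite unitmxE det_map_mx unitfE intr_eq0. Qed.

(** r_k is the frequency that e(s_k . x) acquires under x |-> M^*^{-1} x. *)
Lemma dotR_rvec (R : realType) (d : nat) (M : 'M[int]_d) (s : 'cV[int]_d)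
    (x : 'cV[R]_d) :
  dotR (rvec R M s) x = dotR (intmx R s) (invmx (intmx R M^T) *m x).
Proof.
by rewrite !dotRE /rvec trmx_mul trmx_inv mulmxA (intmx_tr R M).
Qed.

Lemma dotR_int (R : realType) (d : nat) (u z : 'cV[int]_d) :
  exists k : int, dotR (intmx R u) (intmx R z) = k%:~R.
Proof.
exists (\sum_j u j 0 * z j 0); rewrite rmorph_sum.
by apply: eq_bigr => j _; rewrite rmorphM !mxE.
Qed.

Lemma intmxD (R : realType) (d : nat) (u v : 'cV[int]_d) :
  intmx R (u + v) = intmx R u + intmx R v.
Proof. exact: raddfD. Qed.

Lemma intmxM (R : realType) (d : nat) (A : 'M[int]_d) (v : 'cV[int]_d) :
  intmx R (A *m v) = intmx R A *m intmx R v.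
Proof. exact: map_mxM. Qed.

Lemma digits_inj (d m : nat) (A : 'M[int]_d) (s : 'I_m -> 'cV[int]_d)
    (k l : 'I_m) (q : 'cV[int]_d) :
  digits A s -> s k = A *m q + s l -> k = l.
Proof.
move=> [ex_digit _] skl; have [k0 [_ uniq_digit]] := ex_digit (s k).
rewrite -(uniq_digit k) ?(uniq_digit l) //; first by exists q.
by exists 0; rewrite mulmx0 add0r.
Qed.

(** The sum over Z^d / M Z^d of the character chi (n) = e (n . M^*^{-1} z).
    It is nontrivial when z is not in M^* Z^d, and translation by an n with
    chi (n) != 1 permutes the cosets, so that the sum equals chi (n) times
    itself. *)
Lemma sum_character (R : realType) (d m : nat) (M : 'M[int]_d)
    (s : 'I_m -> 'cV[int]_d) (z : 'cV[int]_d) :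
  \det M != 0 -> digits M s -> (forall q, z <> M^T *m q) ->
  \sum_(k < m) cexp2pi (dotR (rvec R M (s k)) (intmx R z)) = 0.
Proof.
move=> M0 Hs zM.
have MU := intmx_unit R M0; have MTU : intmx R M^T \in unitmx.
  by rewrite -intmx_tr unitmx_tr.
pose w := invmx (intmx R M^T) *m intmx R z.
pose chi (n : 'cV[int]_d) : R[i] := cexp2pi (dotR (intmx R n) w).
have chiD u v : chi (u + v) = chi u * chi v.
  by rewrite /chi intmxD dotRDl cexp2piD.
have chiM q : chi (M *m q) = 1.
  have [k kE] := dotR_int R q z.
  rewrite /chi intmxM dotRE trmx_mul -mulmxA (intmx_tr R M) mulKVmx //.
  by rewrite -dotRE kE cexp2pi_int.
(* Otherwise all the entries of w = M^*^{-1} z are integers, and z is in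
   M^* Z^d. *)
have [j chij] : exists j, chi (delta_mx j 0) != 1.
  apply/not_existsP => chi1.
  have wint j : exists k : int, w j 0 = k%:~R.
    apply: cexp2pi_eq1; have /negP := chi1 j; rewrite negbK => /eqP <-.
    rewrite /chi /intmx map_delta_mx dotRE trmx_delta -rowE.
    by rewrite [row _ _ _ _]mxE.
  have [q qE] := choice wint.
  apply: (zM (\col_j q j)); apply: (@intmx_inj R); rewrite intmxM.
  rewrite (_ : intmx R (\col_j q j) = w) ?mulKVmx //.
  by apply/colP => i; rewrite qE !mxE.
have shift k : exists l, exists q, s k + delta_mx j 0 = M *m q + s l.
  by have [l [[q qE] _]] := Hs.1 (s k + delta_mx j 0); exists l, q.
(* The permutation of the digits induced by translation by delta_j. *)
have [sg sgE] := choice shift.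
have sg_inj : injective sg.
  move=> k l kl; have [q qE] := sgE k; have [p pE] := sgE l.
  apply: (digits_inj (q := q - p) Hs); rewrite mulmxBr.
  apply: (addIr (delta_mx j 0)); rewrite qE -[RHS]addrA pE kl.
  by rewrite addrA subrK.
have chi_sg k : chi (s (sg k)) = chi (s k) * chi (delta_mx j 0).
  by have [q qE] := sgE k; rewrite -chiD qE chiD chiM mul1r.
under eq_bigr do rewrite dotR_rvec -/w -/(chi (s _)).
set S := \sum_(k < m) _.
have : S * chi (delta_mx j 0) = S.
  rewrite [RHS](reindex_inj sg_inj) /S mulr_suml.
  by apply: eq_bigr => k _; rewrite chi_sg.
move/eqP; rewrite -subr_eq0 -{2}[S]mulr1 -mulrBr mulf_eq0 subr_eq0.
by rewrite (negbTE chij) orbF => /eqP.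
Qed.

(** Distinct rows l, l' are orthogonal because s^*_l - s^*_l' is not in
    M^* Z^d: the conjugate transpose of this matrix, divided by m, is its
    inverse. *)
Lemma character_unitmx (R : realType) (d m : nat) (M : 'M[int]_d)
    (s sstar : 'I_m -> 'cV[int]_d) :
  \det M != 0 -> digits M s -> digits M^T sstar ->
  \matrix_(l < m, k < m)
     cexp2pi (dotR (rvec R M (s k)) (intmx R (sstar l))) \in unitmx.
Proof.
move=> M0 Hs Hsstar; case: m => [|m] in s sstar Hs Hsstar *.
  by rewrite unitmxE det_mx00 unitr1.
set E := \matrix_(_, _) _.
pose F : 'M[R[i]]_m.+1 := \matrix_(k, l)
  (m.+1%:R^-1 * cexp2pi (dotR (rvec R M (s k)) (intmx R (- sstar l)))).
suff /mulmx1_unit[] : E *m F = 1%:M by [].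
apply/matrixP => l l'; rewrite !mxE.
under eq_bigr do rewrite !mxE mulrCA -cexp2piD -dotRDr -intmxD.
rewrite -mulr_sumr; have [<-|ll'] := eqVneq l l'.
  under eq_bigr => k _.
    rewrite subrr /intmx map_mx0 dotRE mulmx0 mxE cexp2pi0.
    over.
  by rewrite sumr_const card_ord mulVf // pnatr_eq0.
rewrite sum_character ?mulr0 // => q /eqP; rewrite subr_eq => /eqP lq.
by move/eqP: ll'; apply; exact: digits_inj lq.
Qed.

(** A constant vector satisfies the equations by orthogonality to the row of
    0.  Conversely, g minus the constant vector of its mean is killed by every
    row, that of 0 included since its entries are all 1, and the matrix is
    invertible. *)
Lemma character_sums_vanish (R : realType) (d m : nat) (M : 'M[int]_d)
    (s sstar : 'I_m -> 'cV[int]_d) (g : 'I_m -> R[i]) :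
  \det M != 0 -> digits M s -> digits M^T sstar ->
  (forall l, sstar l != 0 ->
     \sum_k cexp2pi (dotR (rvec R M (s k)) (intmx R (sstar l))) * g k = 0) <->
  (forall k, g k = m%:R^-1 * \sum_l g l).
Proof.
move=> M0 Hs Hsstar; case: m => [|m] in s sstar g Hs Hsstar *.
  by split=> _ [].
have mn0 : m.+1%:R != 0 :> R[i] by rewrite pnatr_eq0.
set lam := \sum_k g k.
have sum0 l : sstar l != 0 ->
    \sum_k cexp2pi (dotR (rvec R M (s k)) (intmx R (sstar l))) = 0.
  move=> l0; apply: sum_character => // q lq.
  have s0 : sstar ord0 = 0 by apply: Hsstar.2.
  have l_ord0 : l = ord0.
    by apply: (digits_inj (q := q) Hsstar); rewrite s0 addr0.
  by rewrite l_ord0 s0 eqxx in l0.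
split=> [gE|gE l l0]; last first.
  under eq_bigr do rewrite gE.
  by rewrite -mulr_suml sum0 // mul0r.
pose E : 'M[R[i]]_m.+1 := \matrix_(l, k)
  cexp2pi (dotR (rvec R M (s k)) (intmx R (sstar l))).
have EU : E \in unitmx := character_unitmx R M0 Hs Hsstar.
have : E *m (\col_k (g k - m.+1%:R^-1 * lam)) = 0.
  apply/colP => l; rewrite !mxE.
  under eq_bigr do rewrite !mxE mulrBr.
  rewrite sumrB -mulr_suml; have [l0|l0] := eqVneq (sstar l) 0; last first.
    by rewrite gE // sum0 // mul0r subrr.
  have e1 k : cexp2pi (dotR (rvec R M (s k)) (intmx R (sstar l))) = 1.
    by rewrite l0 /intmx map_mx0 dotRE mulmx0 mxE cexp2pi0.
  under eq_bigr do rewrite e1 mul1r.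
  under [X in _ - X * _]eq_bigr do rewrite e1.
  by rewrite sumr_const card_ord mulrA mulfV // mul1r subrr.
move/(congr1 (mulmx (invmx E))); rewrite mulKmx // mulmx0 => /colP g0 k.
by apply/eqP; have /eqP := g0 k; rewrite !mxE subr_eq0.
Qed.

(** * Derivatives of a polynomial and of its polyphase functions *)

Lemma p2piID (R : realType) (d : nat) (u v : 'cV[R]_d) :
  p2piI (u + v) = p2piI u + p2piI v.
Proof. by apply/colP => j; rewrite !mxE [(u j 0 + v j 0)%:C%C]rmorphD mulrDr. Qed.

Lemma m2piIE (R : realType) (d : nat) (v : 'cV[R]_d) : m2piI v = - p2piI v.
Proof. by apply/colP => j; rewrite !mxE. Qed.

(** G k b is the derivative of order b at 0 of e(r_k . x) tau_k(x), written as
    a sum over the frequencies n + r_k.  Integer frequencies contribute a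
    factor 1 at integer points, which leaves e(r_k . z) in the first formula. *)
Lemma polyphase_derivatives (R : realType) (d m : nat) (M : 'M[int]_d)
    (s : 'I_m -> 'cV[int]_d) (t : 'cV[R]_d -> R[i])
    (tau : 'I_m -> 'cV[R]_d -> R[i]) :
  \det M != 0 -> polyphase M s t tau ->
  exists G : 'I_m -> ('I_d -> nat) -> R[i],
    (forall b z, Dmulti b (dilated M t) (intmx R z) =
       \sum_k cexp2pi (dotR (rvec R M (s k)) (intmx R z)) * G k b) /\
    (forall k a, Dmulti a (tau k) 0 =
       binom_transform (m2piI (rvec R M (s k))) (G k) a).
Proof.
move=> M0 [tau_trig tE].
have [r rP] := choice (fun k => trig_poly_sum (tau_trig k)).
have [c tauE] := choice rP.
pose rho k := rvec R M (s k).
exists (fun k b => \sum_(n <- r k) c k n * midx_pow (p2piI (intmx R n + rho k)) b).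
split=> [b z|k a]; last first.
  rewrite (Dmulti_waves _ (tauE k)) /binom_transform.
  under [RHS]eq_bigr do rewrite -mulrA mulr_suml.
  rewrite exchange_big /=; apply: eq_bigr => n _.
  rewrite dotRE mulmx0 mxE cexp2pi0 mulr1.
  under [RHS]eq_bigr do rewrite -mulrA.
  rewrite -mulr_sumr; congr (_ * _).
  have -> : p2piI (intmx R n) =
      p2piI (intmx R n + rho k) + m2piI (rvec R M (s k)).
    by rewrite p2piID m2piIE addrK.
  by rewrite midx_pow_binomial; apply: eq_bigr => b _; rewrite -mulrA.
have TE x : dilated M t x =
    \sum_(p <- [seq (k, n) | k <- enum 'I_m, n <- r k])
      c p.1 p.2 * cexp2pi (dotR (intmx R p.2 + rho p.1) x).
  rewrite big_allpairs_dep big_enum /= /dilated tE; apply: eq_bigr => k _.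
  rewrite mulKVmx ?tauE; last first.
    by rewrite -intmx_tr unitmx_tr; exact: intmx_unit.
  rewrite mulr_sumr; apply: eq_bigr => n _.
  by rewrite dotRDl cexp2piD dotZE -dotR_rvec mulrCA [cexp2pi _ * cexp2pi _]mulrC.
rewrite (Dmulti_waves _ TE) big_allpairs_dep big_enum /=.
apply: eq_bigr => k _; rewrite mulr_sumr; apply: eq_bigr => n _.
have [q qE] := dotR_int R n z.
by rewrite dotRDl cexp2piD qE cexp2pi_int mul1r mulrC.
Qed.

(* The multi-indices b <= a are enumerated as the b : {ffun 'I_d -> 'I_N} with
   N = [a] + 1 satisfying b_j <= a_j for all j; the bound N is never active. *)
Theorem theorem11 (R : realType) (d : nat) (M : 'M[int]_d)
    (HM : dilation_matrix R M)
    (s sstar : 'I_(`|\det M|%N) -> 'cV[int]_d)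
    (Hs : digits M s) (Hsstar : digits M^T sstar)
    (n : nat) (t : 'cV[R]_d -> R[i]) (Ht : trig_poly t)
    (tau : 'I_(`|\det M|%N) -> 'cV[R]_d -> R[i])
    (Htau : polyphase M s t tau) :
  classZ M sstar n t <->
  (forall (k : 'I_(`|\det M|%N)) (a : 'I_d -> nat), (midx_sum a <= n)%N ->
     Dmulti a (tau k) 0 =
       (`|\det M|%N)%:R^-1 *
       \sum_(b : {ffun 'I_d -> 'I_(midx_sum a).+1} |
               [forall j, (b j <= a j)%N])
          lambda_coef M t (fun j => b j)
          * (midx_binom a (fun j => b j))%:R
          * midx_pow (m2piI (rvec R M (s k))) (fun j => (a j - b j)%N)).
Proof.
have M0 := HM.1.
have [G [tD tauD]] := polyphase_derivatives M0 Htau.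
have lamE b : lambda_coef M t b = \sum_k G k b.
  rewrite /lambda_coef -[0](_ : intmx R 0 = 0); last exact: map_mx0.
  rewrite tD; apply: eq_bigr => k _.
  by rewrite /intmx map_mx0 dotRE mulmx0 mxE cexp2pi0 mul1r.
have rhsE k a : (`|\det M|%N)%:R^-1 * binom_transform (m2piI (rvec R M (s k)))
      (lambda_coef M t) a =
    binom_transform (m2piI (rvec R M (s k)))
      (fun b => (`|\det M|%N)%:R^-1 * \sum_l G l b) a.
  by rewrite mulr_sumr; apply: eq_bigr => b _; rewrite lamE !mulrA.
have character_sums b := character_sums_vanish (fun k => G k b) M0 Hs Hsstar.
split=> [[_ tZ] k a an|tauP].
  rewrite -/(binom_transform _ _ _) rhsE tauD.
  move: a an; apply/binom_transform_inj => b bn.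
  by move: k; apply/character_sums => l l0; rewrite -tD tZ.
split=> // l l0 b bn; rewrite tD; move: l l0; apply/character_sums => k.
move: b bn; apply/(binom_transform_inj (m2piI (rvec R M (s k)))) => a an.
by rewrite -rhsE -tauD tauP.
Qed.
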